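(* (1) For every integer $p\ge 1$, the period of the out-shuffle of a deck of $2^p$ cards is $p$. (2) For every integer $p\ge 1$, the period of the out-shuffle of a deck of $2^p+2$ cards is $2p$.
   Context: For a deck of $2n$ cards ($n\ge 1$), the out-shuffle is the permutation $g$ of $\{1,\dots,2n\}$ defined by $g(i)=i/2+n$ if $i$ is even, and $g(i)=(i+1)/2$ if $i$ is odd (after cutting the deck into cards $1,\dots,n$ and $n+1,\dots,2n$ and interleaving perfectly starting with the first packet, $g(i)$ is the number of the card at position $i$ from the bottom). The period of the shuffle is the smallest integer $s\ge 1$ such that $g^s=\mathrm{id}$ ($s$-fold composition). *)

(* Defs.v *)
From mathcomp Require Import all_boot all_fingroup.

Set Implicit Arguments.
Unset Strict Implicit.
Unset Printing Implicit Defensive.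

(* Positions and cards are numbered from 1 to 2n. *)
Definition shuffle_card (n i : nat) : nat :=
  if odd i then i.+1./2 else i./2 + n.

Lemma shuffle_card_bounds (n i : nat) :
  0 < i <= 2 * n -> 0 < shuffle_card n i <= 2 * n.
Proof.
rewrite mul2n /shuffle_card => /andP[i_gt0 le_i].
have Ei := odd_double_half i; case: ifP Ei => odd_i Ei.
  rewrite -Ei /= ltn_double in le_i *.
  by rewrite doubleK (leq_trans le_i) // -addnn leq_addr.
rewrite add0n in Ei; rewrite -Ei double_gt0 in i_gt0.
by rewrite -Ei leq_double in le_i; rewrite addn_gt0 i_gt0 /= -addnn leq_add2r.
Qed.

Lemma shuffle_card_inj (n i j : nat) :
  0 < i <= 2 * n -> 0 < j <= 2 * n ->
  shuffle_card n i = shuffle_card n j -> i = j.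
Proof.
rewrite mul2n /shuffle_card => /andP[i_gt0 le_i] /andP[j_gt0 le_j].
have Ei := odd_double_half i; have Ej := odd_double_half j.
case: (odd i) Ei => Ei; case: (odd j) Ej => Ej;
  rewrite -{}Ei -{}Ej /= ?add0n ?add1n in i_gt0 le_i j_gt0 le_j *;
  rewrite ?ltn_double ?leq_double ?double_gt0 ?doubleK
    in i_gt0 le_i j_gt0 le_j *.
- by case=> ->.
- by move=> E; move: le_i; rewrite E -{2}[n]add0n leq_add2r leqNgt j_gt0.
- by move=> E; move: le_j; rewrite -E -{2}[n]add0n leq_add2r leqNgt i_gt0.
- by move/addIn=> ->.
Qed.

(* The ordinal i : 'I_(2 * n) stands for the number i + 1. *)
Lemma shuffle_ord_subproof (n : nat) (i : 'I_(2 * n)) :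
  (shuffle_card n i.+1).-1 < 2 * n.
Proof.
by have /andP[s_gt0] := @shuffle_card_bounds n i.+1 (ltn_ord i); rewrite prednK.
Qed.

Definition shuffle_ord (n : nat) (i : 'I_(2 * n)) : 'I_(2 * n) :=
  Ordinal (shuffle_ord_subproof i).

Lemma shuffle_ord_inj (n : nat) : injective (@shuffle_ord n).
Proof.
move=> i j /(congr1 val) /= /(congr1 S).
have /andP[si _] := @shuffle_card_bounds n i.+1 (ltn_ord i).
have /andP[sj _] := @shuffle_card_bounds n j.+1 (ltn_ord j).
rewrite !prednK // => /shuffle_card_inj Eij.
by apply/val_inj/succn_inj/Eij; apply: ltn_ord.
Qed.

Definition out_shuffle (n : nat) : {perm 'I_(2 * n)} :=
  perm (@shuffle_ord_inj n).

Lemma out_shuffleE (n : nat) (i : 'I_(2 * n)) :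
  (out_shuffle n i).+1 = shuffle_card n i.+1.
Proof.
rewrite permE /= prednK //.
by have /andP[] := @shuffle_card_bounds n i.+1 (ltn_ord i).
Qed.

Definition is_period (T : finType) (g : {perm T}) (s : nat) : Prop :=
  [/\ 0 < s, (g ^+ s = 1)%g
    & forall t : nat, 0 < t -> (g ^+ t = 1)%g -> s <= t].

(* Main.v *)
(** Number the positions from [0] and put [m = 2n - 1].  One shuffle [g] satisfies [2 * g j = j %[mod m]], so [g ^+ t = 1] exactly when [2 ^ t = 1 %[mod m]]; the residue [0], which occurs at both ends of the deck, is harmless because [g] fixes position [0].  The period is thus the multiplicative order of [2] modulo [2 ^ p - 1] or [2 ^ p + 1], which follows by comparing sizes. *)
Require Import Defs.
From mathcomp Require Import all_boot all_fingroup zify.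

Lemma shuffle_card_double (n i : nat) :
  0 < n -> 0 < i -> (shuffle_card n i).-1.*2 = i.-1 %[mod n.*2.-1].
Proof.
move=> n_gt0 i_gt0; rewrite /shuffle_card; case: ifP => odd_i.
  by congr (_ %% _); lia.
(* For even [i], doubling overshoots [i.-1] by exactly one modulus; for odd [i] the equality is
   exact. *)
rewrite (_ : _.*2 = i.-1 + n.*2.-1) ?modnDr //; lia.
Qed.

Lemma out_shuffle_double (n : nat) (i : 'I_(2 * n)) :
  (out_shuffle n i).*2 = i %[mod n.*2.-1].
Proof.
have n_gt0 : 0 < n by have := ltn_ord i; lia.
by have := shuffle_card_double n i.+1 n_gt0 isT; rewrite -out_shuffleE.
Qed.

(** Keeping [2 ^ t] on the left avoids inverting 2 modulo [n.*2.-1]. *)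
Lemma out_shuffleX_mod (n t : nat) (i : 'I_(2 * n)) :
  2 ^ t * (out_shuffle n ^+ t)%g i = i %[mod n.*2.-1].
Proof.
elim: t i => [|t IHt] i; first by rewrite expg0 perm1 mul1n.
rewrite expgS permM expnS -mulnA -modnMmr IHt modnMmr mul2n.
exact: out_shuffle_double.
Qed.

Lemma out_shuffle_eq0 (n : nat) (i : 'I_(2 * n)) :
  ((out_shuffle n i : nat) == 0) = ((i : nat) == 0).
Proof.
have := out_shuffleE i; have := ltn_ord i.
rewrite /shuffle_card; case: ifP; lia.
Qed.

Lemma out_shuffleX_eq0 (n t : nat) (i : 'I_(2 * n)) :
  (((out_shuffle n ^+ t)%g i : nat) == 0) = ((i : nat) == 0).
Proof.
elim: t i => [|t IHt] i; first by rewrite expg0 perm1.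
by rewrite expgS permM IHt out_shuffle_eq0.
Qed.

(** The residues are taken in 1..m because, once position 0 is set apart, the last position is m
    itself. *)
Lemma eq_modn_pos (m i j : nat) :
  0 < i <= m -> 0 < j <= m -> i = j %[mod m] -> i = j.
Proof.
move=> /andP[i_gt0 le_im] /andP[j_gt0 le_jm] /eqP eq_ij.
wlog le_ij : i j i_gt0 j_gt0 le_im le_jm eq_ij / i <= j.
  by case: (leqP i j) => [|/ltnW] le W; [|symmetry]; apply: W; rewrite // eq_sym.
move: eq_ij; rewrite eq_sym eqn_mod_dvd //.
case: (posnP (j - i)) => [|ji_gt0 /(dvdn_leq ji_gt0)]; lia.
Qed.

Lemma out_shuffleX_eq1 (n t : nat) :
  0 < n -> (out_shuffle n ^+ t = 1)%g <-> n.*2.-1 %| 2 ^ t - 1.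
Proof.
move=> n_gt0; rewrite -eqn_mod_dvd ?expn_gt0 //; split=> [g1|/eqP t1].
  (* Position 1 serves as witness: if it is fixed, the congruence reads [2 ^ t = 1]. *)
  have lt1 : 1 < 2 * n by lia.
  by have := out_shuffleX_mod n t (Ordinal lt1); rewrite g1 perm1 muln1 => ->.
apply/permP => i; rewrite perm1; apply: val_inj => /=.
have := out_shuffleX_mod n t i; rewrite -modnMml t1 modnMml mul1n.
have := out_shuffleX_eq0 n t i.
have := ltn_ord i; have := ltn_ord ((out_shuffle n ^+ t)%g i).
move: (nat_of_ord _) (nat_of_ord _) => a b lt_a lt_b ab0.
case: (posnP a) ab0 => [->|a_gt0] ab0; first by lia.
by apply: eq_modn_pos; lia.
Qed.

Lemma is_period_out_shuffle (n s : nat) :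
  0 < n -> 0 < s -> n.*2.-1 %| 2 ^ s - 1 ->
  (forall t, 0 < t -> n.*2.-1 %| 2 ^ t - 1 -> s <= t) ->
  is_period (out_shuffle n) s.
Proof.
move=> n_gt0 s_gt0 s1 s_min; split=> // [|t t_gt0]; first exact/out_shuffleX_eq1.
by move/(out_shuffleX_eq1 n t n_gt0); apply: s_min.
Qed.

Lemma leq_order2_pred (p t : nat) : 0 < t -> 2 ^ p - 1 %| 2 ^ t - 1 -> p <= t.
Proof.
(* As [2 ^ t - 1] is nonzero, its divisors are at most as large. *)
move=> t_gt0 dvd_t; have t_gt1 : 1 < 2 ^ t by rewrite -{1}(expn0 2) ltn_exp2l.
by rewrite -(@leq_exp2l 2) //; move/dvdn_leq: dvd_t; lia.
Qed.

Lemma leq_order2_succ (p t : nat) :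
  0 < t -> 2 ^ p + 1 %| 2 ^ t - 1 -> 2 * p <= t.
Proof.
move=> t_gt0 dvd_t; have t_gt1 : 1 < 2 ^ t by rewrite -{1}(expn0 2) ltn_exp2l.
(* Size alone gives this first bound, so [t - p] is not truncated. *)
have lt_pt : p < t.
  by rewrite -(@ltn_exp2l 2) //; move/dvdn_leq: dvd_t; lia.
(* [2 ^ p = -1] modulo [2 ^ p + 1], hence [2 ^ t = - 2 ^ (t - p)]. *)
have : 2 ^ p + 1 %| 2 ^ (t - p) + 1.
  rewrite -(dvdn_addr _ dvd_t).
  rewrite (_ : 2 ^ t - 1 + _ = 2 ^ (t - p) * (2 ^ p + 1)) ?dvdn_mull //.
  by rewrite mulnDr -expnD subnK ?(ltnW lt_pt) //; lia.
(* Comparing sizes again gives [p <= t - p]. *)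
rewrite !addn1 => /(dvdn_leq (ltn0Sn _)); rewrite ltnS leq_exp2l //; lia.
Qed.

Theorem mainTheorem5 :
  (forall p n : nat, 1 <= p -> 2 * n = 2 ^ p -> is_period (out_shuffle n) p)
  /\
  (forall p n : nat, 1 <= p -> 2 * n = 2 ^ p + 2 ->
     is_period (out_shuffle n) (2 * p)).
Proof.
split=> p n p_gt0 def_n; have pow_gt0 : 0 < 2 ^ p by rewrite expn_gt0.
  have def_m : n.*2.-1 = 2 ^ p - 1 by lia.
  apply: is_period_out_shuffle; rewrite ?def_m //; first by lia.
  by move=> t; apply: leq_order2_pred.
have def_m : n.*2.-1 = 2 ^ p + 1 by lia.
apply: is_period_out_shuffle; rewrite ?def_m //; [lia | lia | | ].
  (* Difference of squares: [2 ^ (2 * p) - 1 = (2 ^ p - 1) * (2 ^ p + 1)]. *)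
  by rewrite mulnC expnM -[X in _ - X](exp1n 2) subn_sqr dvdn_mull.
by move=> t; apply: leq_order2_succ.
Qed.
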